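(* Let $a$ and $b$ be real numbers with $e \leq a < b$, where $e$ is the base of the natural logarithm. Then $b^{a} < a^{b}$. *)

(* Defs.v *)
From Stdlib Require Export Reals.

(* Main.v *)
(** With [t = ln (b / a) > 0], the bound [1 + t < exp t = b / a] gives
    [a * ln b - a * ln a = a * t < b - a], and [b - a <= (b - a) * ln a]
    because [ln a >= 1]. Hence [a * ln b < b * ln a]. *)
Require Import Defs.
From Stdlib Require Import Reals.
From Stdlib Require Import Lra.
Open Scope R_scope.

Theorem mainTheorem1 (a b : R) (hab : exp 1 <= a < b) :
  Rpower b a < Rpower a b.
Proof.
  destruct hab as [hea hltab].
  assert (ha : 0 < a) by (pose proof (exp_pos 1); lra).
  assert (hb : 0 < b) by lra.
  assert (hlna : 1 <= ln a).
  { apply Rnot_lt_le. intros hlt.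
    apply exp_increasing in hlt. rewrite (exp_ln a ha) in hlt. lra. }
  assert (hln : ln a < ln b) by (apply ln_increasing; lra).
  (* The inequality is strict because [hln] makes the exponent positive. *)
  assert (ht : 1 + (ln b - ln a) < exp (ln b - ln a)) by (apply exp_ineq1; lra).
  assert (hexp : a * exp (ln b - ln a) = b).
  (* Only the outer factor [a] becomes [exp (ln a)]; the [a] inside [ln a] stays, so the exponents
     add up to [ln b]. *)
  { rewrite <- (exp_ln a ha) at 1.
    rewrite <- exp_plus, Rplus_minus.
    exact (exp_ln b hb). }
  unfold Rpower. apply exp_increasing.
  apply (Rmult_lt_compat_l a) in ht; [| exact ha].
  assert (0 <= (b - a) * (ln a - 1)) by (apply Rmult_le_pos; lra).
  (* Linear once [a * ln b], [a * ln a], [b * ln a] and [a * exp (ln b - ln a)] count as atoms: [ht]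
     and [hexp] give [a * ln b < b - a + a * ln a], and the last bound puts this at most
     [b * ln a]. *)
  lra.
Qed.
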